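(* (i) If $\mathcal{H}$ is a 3-uniform hypergraph on $n$ vertices without isolated vertices, then $\gamma_g(\mathcal{H})\le \frac{5}{9}n$. (ii) If $G$ is a graph of order $n$ without isolated vertices in which every edge belongs to a triangle, then $\gamma_g(G)\le \frac{5}{9}n$.
   Context: Hypergraphs and graphs are finite. In a hypergraph (or graph), two distinct vertices are adjacent if some edge contains both; $N[v]$ is $v$ together with all vertices adjacent to $v$, and $N[S]=\bigcup_{v\in S}N[v]$. The domination game: Dominator and Staller alternately choose vertices $v_1,v_2,\dots$; with $D_i=\{v_1,\dots,v_i\}$, each chosen vertex must satisfy $N[v_i]\setminus N[D_{i-1}]\ne\emptyset$, and the game ends when $N[D_d]$ is the whole vertex set. Dominator aims to minimize the number of moves, Staller to maximize it. $\gamma_g$ denotes the number of moves under optimal play when Dominator makes the first move. *)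

(* Defs.v *)
From mathcomp Require Import all_boot.
Set Implicit Arguments. Unset Strict Implicit. Unset Printing Implicit Defensive.

Section DomGame.
Variable V : finType.

(* A closed-neighbourhood function N : V -> {set V} (with v \in N v).
   The state of the domination game is the set S = N[D] of dominated
   vertices; a vertex v is a legal move iff N v is not contained in S.
   [gval N fuel dom S] is the number of remaining moves under optimal play
   (Dominator minimizing, Staller maximizing) when it is Dominator's turn
   iff [dom] is true.  Each move dominates a new vertex, so fuel #|V|
   suffices. *)
Fixpoint gval (N : V -> {set V}) (fuel : nat) (dom : bool) (S : {set V}) : nat :=
  match fuel with
  | 0 => 0
  | fuel'.+1 =>
    let L := [seq v <- enum V | ~~ (N v \subset S)] in
    let vals := [seq gval N fuel' (~~ dom) (S :|: N v) | v <- L] in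
    if L is [::] then 0
    else (foldr (if dom then minn else maxn) (head 0 vals) vals).+1
  end.

Definition gamma_g (N : V -> {set V}) : nat := gval N #|V| true set0.

Definition hnbhd (E : {set {set V}}) (v : V) : {set V} :=
  v |: [set u | [exists e in E, (v \in e) && (u \in e)]].

Definition gnbhd (r : rel V) (v : V) : {set V} := v |: [set u | r v u].

End DomGame.

(* Main.v *)
Require Import Defs.
From mathcomp Require Import all_boot.
From mathcomp Require Import zify.

(* Both parts are the same statement about closed neighbourhoods in a graph
   where every edge lies in a triangle.  An undominated vertex weighs 15, and a
   dominated vertex with k undominated neighbours weighs b k with b 0 = 0.
   Dominator can always make his move together with Staller's reply decrease the
   total weight, initially 15n, by 54; hence 27 per move, and 15/27 = 5/9.
   The function b is lowered pointwise as the largest number of vertices that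
   one move can newly dominate falls: b = 9 on positive arguments at first, then
   (7, 7, 9, 9) once it is at most 4, and (6, 7, 9) once it is at most 3. *)

Ltac nat_lia :=
  repeat match goal with
  | H : ?P |- _ =>
    lazymatch P with
    | is_true (leq _ _) => fail
    | is_true (leq _ _ && leq _ _) => fail
    | @eq nat _ _ => fail
    | _ => clear H
    end
  end; lia.

Section DominationGame.

Variables (V : finType) (N : V -> {set V}).
Hypothesis Nrefl : forall x, x \in N x.
Hypothesis Nsym : forall x y, x \in N y -> y \in N x.
Hypothesis Nneighbour : forall x, exists2 y, y \in N x & y != x.
Hypothesis Ntriangle : forall x y, y \in N x -> y != x ->
  exists z, [/\ z != x, z != y, z \in N x & z \in N y].

Implicit Types (S : {set V}) (b : nat -> nat).

(** * The recursion of the game value *)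

Lemma foldr_minn_le (d : nat) (s : seq nat) (m : nat) :
  m \in s -> foldr minn d s <= m.
Proof.
elim: s => //= a s IH; rewrite inE => /orP[/eqP-> | /IH le_m].
  exact: geq_minl.
exact: leq_trans (geq_minr _ _) le_m.
Qed.

Lemma foldr_maxn_le (d : nat) (s : seq nat) (m : nat) :
  d <= m -> {in s, forall a, a <= m} -> foldr maxn d s <= m.
Proof.
move=> d_le; elim: s => //= a s IH s_le; rewrite geq_max s_le ?mem_head //=.
by apply: IH => c sc; apply: s_le; rewrite inE sc orbT.
Qed.

Definition fresh S v := N v :\: S.

Lemma in_fresh S v x : (x \in fresh S v) = (x \notin S) && (x \in N v).
Proof. by rewrite inE. Qed.

Definition legal S v := ~~ (N v \subset S).

Lemma legalP S v : reflect (exists u, u \in fresh S v) (legal S v).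
Proof.
apply: (iffP subsetPn) => [[u Nu Su] | [u]].
  by exists u; rewrite in_fresh Su.
by rewrite in_fresh => /andP[Su Nu]; exists u.
Qed.

Lemma gval_Dominator k S v : legal S v ->
  gval N k.+1 true S <= (gval N k false (S :|: N v)).+1.
Proof.
move=> lv /=; have: v \in [seq w <- enum V | ~~ (N w \subset S)].
  by rewrite mem_filter mem_enum inE andbT.
case: {-2}[seq w <- enum V | _] (erefl [seq w <- enum V | ~~ (N w \subset S)])
  => // w0 s E vs.
rewrite ltnS; apply: foldr_minn_le.
exact: (map_f (fun v => gval N k false (S :|: N v))).
Qed.

Lemma gval_Staller k S m :
    (forall w, legal S w -> gval N k true (S :|: N w) <= m) ->
  gval N k.+1 false S <= m.+1.
Proof.
move=> le_m /=.
have le_s w : w \in [seq w <- enum V | ~~ (N w \subset S)] ->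
    gval N k true (S :|: N w) <= m.
  by rewrite mem_filter => /andP[/le_m].
case: [seq w <- enum V | _] le_s => // w0 s le_s.
(* The fold starts from the value of the first legal move [w0], so this default needs the bound as
   well. *)
rewrite ltnS; apply: foldr_maxn_le => [|_ /mapP[w ws ->]]; last exact: le_s.
by apply: le_s; rewrite mem_head.
Qed.

Lemma gval_final k dom S : (forall v, ~~ legal S v) -> gval N k dom S = 0.
Proof.
move=> fin; case: k => //= k.
have ->: [seq v <- enum V | ~~ (N v \subset S)] = [::].
  by apply/eqP; rewrite -(negbK (_ == _)) -has_filter; apply/hasPn => v _; apply: fin.
by [].
Qed.

(** * Weights, potential, and the loss caused by one move *)

Definition wt b S x := if x \in S then b #|fresh S x| else 15.
Definition pot b S := \sum_x wt b S x.
Definition drop b S v x := wt b S x - wt b (S :|: N v) x.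

(** Monotonicity and the cap 15 keep any move from raising a weight, so the truncated subtraction in
    [drop] is exact. [b 0 = 0] makes a vertex with nothing left to dominate weigh nothing. *)
Definition weights b := [/\ b 0 = 0, {homo b : m n / m <= n} & forall n, b n <= 15].

Lemma fresh_sub S A x : fresh (S :|: A) x \subset fresh S x.
Proof. by apply/subsetP => y; rewrite !inE negb_or => /andP[/andP[-> _] ->]. Qed.

Lemma wt_mono b S A x : weights b -> wt b (S :|: A) x <= wt b S x.
Proof.
case=> b0 bm b15; rewrite /wt inE; case: (x \in S) => /=.
  exact/bm/subset_leq_card/fresh_sub.
by case: ifP.
Qed.

(** No vertex gains weight, so vertices outside [s] can be ignored. Each later case lists only the
    vertices whose loss it estimates. *)
Lemma pot_gain b S v s : weights b -> uniq s ->
  pot b (S :|: N v) + \sum_(x <- s) drop b S v x <= pot b S.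
Proof.
move=> wb us; rewrite big_uniq // big_mkcond /= -big_split /=.
apply: leq_sum => x _; have := wt_mono b S (N v) x wb.
by case: ifP; rewrite /drop; nat_lia.
Qed.

(** The vertices of [s] lie in [fresh S x] and leave it when [v] is played, so they are disjoint
    from what remains. *)
Lemma fresh_after S v x s : uniq s ->
    {in s, forall y, [/\ y \notin S, y \in N v & y \in N x]} ->
  #|fresh (S :|: N v) x| + size s <= #|fresh S x|.
Proof.
move=> us sP; rewrite -(card_uniqP us) -cardUI.
set I := [predI _ & _]; have /eq_card0->: I =i pred0.
  move=> y; rewrite !inE; apply/negP => /andP[/andP[+ _] /sP[_ vy _]].
  by rewrite vy orbT.
rewrite addn0; apply/subset_leq_card/subsetP => y.
rewrite !inE => /orP[/andP[] | /sP[-> _ ->] //].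
by rewrite negb_or => /andP[-> _] ->.
Qed.

Lemma fresh_after1 S v x u : u \notin S -> u \in N v -> u \in N x ->
  #|fresh (S :|: N v) x| < #|fresh S x|.
Proof.
move=> Su vu xu; rewrite -addn1; apply: (@fresh_after S v x [:: u]) => // y.
by rewrite inE => /eqP->.
Qed.

Lemma fresh_after2 S v x u w : u != w ->
    u \notin S -> u \in N v -> u \in N x ->
    w \notin S -> w \in N v -> w \in N x ->
  #|fresh (S :|: N v) x|.+2 <= #|fresh S x|.
Proof.
move=> uw Su vu xu Sw vw xw; rewrite -addn2.
apply: (@fresh_after S v x [:: u; w]) => [|y]; first by rewrite /= inE uw.
by rewrite !inE => /orP[] /eqP->.
Qed.

Lemma drop_white b S v x k : weights b -> x \notin S -> x \in N v ->
  #|fresh (S :|: N v) x| <= k -> 15 - b k <= drop b S v x.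
Proof.
move=> [_ bm _] Sx vx /bm le_b; rewrite /drop /wt inE (negPf Sx) vx /=; nat_lia.
Qed.

Lemma drop_blue b S v x : x \in S ->
  drop b S v x = b #|fresh S x| - b #|fresh (S :|: N v) x|.
Proof. by move=> Sx; rewrite /drop /wt inE Sx. Qed.

Lemma drop_self b S v : weights b -> drop b S v v = wt b S v.
Proof.
move=> [b0 _ _]; rewrite /drop {2}/wt inE Nrefl orbT.
suff ->: fresh (S :|: N v) v = set0 by rewrite cards0 b0 subn0.
by apply/setP => y; rewrite !inE; case: (y \in N v); rewrite ?orbT ?andbF.
Qed.

Lemma wt_blue b S v u : weights b -> v \in S -> u \in fresh S v -> b 1 <= wt b S v.
Proof.
move=> [_ bm _] Sv uv; rewrite /wt Sv; apply: bm.
by apply/card_gt0P; exists u.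
Qed.

Lemma wt_white b S v : v \notin S -> wt b S v = 15.
Proof. by rewrite /wt => /negPf->. Qed.

(* [27 <= d] pays for a game that ends with this move of Dominator. *)
Definition advance (F : {set V} -> nat) S :=
  exists v d s, [/\ legal S v, F (S :|: N v) + d <= F S,
    forall w, legal (S :|: N v) w -> F (S :|: N v :|: N w) + s <= F (S :|: N v),
    27 <= d & 54 <= d + s].

(** Induction over rounds, two moves at a time. [P] is the invariant of a phase; in each position of
    the phase Dominator either advances, or the bound is already known because a later phase has
    been reached. *)
Lemma potential_bound (P : {set V} -> Prop) (F : {set V} -> nat) :
    (forall S A, P S -> P (S :|: A)) ->
    (forall S, P S -> advance F S \/ forall k, 27 * gval N k true S <= F S) ->
  forall k S, P S -> 27 * gval N k true S <= F S.
Proof.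
move=> Pmono PF k; have [m] := ubnP k; elim: m k => // m IH k.
rewrite ltnS => le_km S PS; case: (PF S PS) => // -[v [d [s [lv Fd Fs d27 ds]]]].
(* With fuel 0 or 1, or with no reply left, at most one move is counted, and [d27] pays for it. *)
case: k le_km => [|k] lt_km; first by rewrite muln0.
have := gval_Dominator k S v lv.
case: k lt_km => [|k] lt_km; first by rewrite [gval N 0 _ _]/=; nat_lia.
have [/existsP[w0 lw0] | /existsPn fin] := boolP [exists w, legal (S :|: N v) w]; last first.
  by rewrite (gval_final k.+1) //; nat_lia.
have := gval_Staller k (S :|: N v) ((F S - 54) %/ 27).
have le_w w : legal (S :|: N v) w ->
    gval N k true (S :|: N v :|: N w) <= (F S - 54) %/ 27.
  move=> lw; rewrite leq_divRL // mulnC; apply: leq_trans (IH k _ _ _) _ => //.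
  - by nat_lia.
  - exact/Pmono/Pmono.
  by have := Fs w lw; nat_lia.
(* The legal reply [w0] shows [54 <= F S], so subtracting 54 is exact here. *)
move=> /(_ le_w); have := Fs w0 lw0; have := leq_trunc_div (F S - 54) 27; nat_lia.
Qed.

(** * The weight functions of the three phases *)

Definition b0 k := if k is 0 then 0 else 9.
Definition b1 k := match k with 0 => 0 | 1 | 2 => 7 | _ => 9 end.
Definition b2 k := match k with 0 => 0 | 1 => 6 | 2 => 7 | _ => 9 end.

Lemma weights_b0 : weights b0.
Proof. by split=> // [[|m] [|n]|[|n]]. Qed.

Lemma weights_b1 : weights b1.
Proof. by split=> // [[|[|[|m]]] [|[|[|n]]]|[|[|[|n]]]]. Qed.

Lemma weights_b2 : weights b2.
Proof. by split=> // [[|[|[|m]]] [|[|[|n]]]|[|[|[|n]]]]. Qed.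

Lemma pot_le b b' S :
    (forall x, x \in S -> b #|fresh S x| <= b' #|fresh S x|) ->
  pot b S <= pot b' S.
Proof. by move=> le_b; apply: leq_sum => x _; rewrite /wt; case: ifP => // /le_b. Qed.

Definition fresh_le m S := forall x, #|fresh S x| <= m.

Lemma fresh_le_mono m S A : fresh_le m S -> fresh_le m (S :|: A).
Proof. move=> Sm x; exact/(leq_trans _ (Sm x))/subset_leq_card/fresh_sub. Qed.

(** An undominated [v] loses its whole 15. A dominated [v] loses 9, and a newly dominated [u] loses
    at least 15 - 9 = 6. *)
Lemma Staller_b0 S v : legal S v -> pot b0 (S :|: N v) + 15 <= pot b0 S.
Proof.
case/legalP=> u uv; have [Sv | Sv] := boolP (v \in S); last first.
  apply: leq_trans (pot_gain b0 S v [:: v] weights_b0 isT); rewrite leq_add2l.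
  by rewrite big_seq1 drop_self ?wt_white //; apply: weights_b0.
have := uv; rewrite in_fresh => /andP[Su vu].
have nvu: v != u by apply: contraNneq Su => <-.
have us: uniq [:: v; u] by rewrite /= inE nvu.
apply: leq_trans (pot_gain b0 S v _ weights_b0 us); rewrite leq_add2l.
rewrite !big_cons big_nil drop_self; last exact: weights_b0.
have := wt_blue b0 S v u weights_b0 Sv uv.
have := drop_white b0 S v u _ weights_b0 Su vu (leqnn _).
by case: #|_| => /= [|?]; nat_lia.
Qed.

(** A dominated [v] loses at least [b1 1 = 7], and a newly dominated [u] at least 15 - 9 = 6. *)
Lemma Staller_b1 S v : fresh_le 4 S -> legal S v ->
  pot b1 (S :|: N v) + 13 <= pot b1 S.
Proof.
move=> S4; case/legalP=> u uv; have [Sv | Sv] := boolP (v \in S); last first.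
  apply: leq_trans (pot_gain b1 S v [:: v] weights_b1 isT); rewrite leq_add2l.
  by rewrite big_seq1 drop_self ?wt_white //; apply: weights_b1.
have := uv; rewrite in_fresh => /andP[Su vu].
have nvu: v != u by apply: contraNneq Su => <-.
have us: uniq [:: v; u] by rewrite /= inE nvu.
apply: leq_trans (pot_gain b1 S v _ weights_b1 us); rewrite leq_add2l.
rewrite !big_cons big_nil drop_self; last exact: weights_b1.
have := wt_blue b1 S v u weights_b1 Sv uv.
have le3: #|fresh (S :|: N v) u| <= 3.
  by have := fresh_after1 S v u u Su vu (Nrefl u); have := S4 u; nat_lia.
by have := drop_white b1 S v u 3 weights_b1 Su vu le3; rewrite /=; nat_lia.
Qed.

(** [b2] is strictly increasing on 0, ..., 3; beyond 3 it is constant, hence the hypothesis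
    [fresh_le 3 S]. *)
Lemma drop_b2_blue1 S v x u : fresh_le 3 S -> x \in S ->
  u \notin S -> u \in N v -> u \in N x -> 0 < drop b2 S v x.
Proof.
move=> S3 Sx Su vu xu; rewrite drop_blue //.
have := fresh_after1 S v x u Su vu xu; have := S3 x.
case: #|fresh S x| => [|[|[|[|?]]]] //; case: #|_| => [|[|[|?]]] //; nat_lia.
Qed.

(** The smallest increase of [b2] over two steps within 0, ..., 3 is [b2 3 - b2 1 = 3]. *)
Lemma drop_b2_blue2 S v x u w : fresh_le 3 S -> x \in S -> u != w ->
    u \notin S -> u \in N v -> u \in N x ->
    w \notin S -> w \in N v -> w \in N x ->
  3 <= drop b2 S v x.
Proof.
move=> S3 Sx uw Su vu xu Sw vw xw; rewrite drop_blue //.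
have := fresh_after2 S v x u w uw Su vu xu Sw vw xw; have := S3 x.
case: #|fresh S x| => [|[|[|[|?]]]] //; case: #|_| => [|[|?]] //; nat_lia.
Qed.

(** An undominated [x] belongs to its own [fresh] set and leaves it once dominated, so at most [m]
    vertices remain there. *)
Lemma drop_b2_white S v x m : (forall y, y \notin S -> #|fresh S y| <= m.+1) ->
  x \notin S -> x \in N v -> 15 - b2 m <= drop b2 S v x.
Proof.
move=> Sm Sx vx; apply: drop_white => //; first exact: weights_b2.
by rewrite -ltnS (leq_trans _ (Sm x Sx)) // (fresh_after1 S v x x).
Qed.

(** A dominated [v] loses at least 6, a newly dominated [u] at least [15 - b2 m], and the third
    vertex of a triangle on [v] and [u] at least 1. An undominated [v] loses 15 and a neighbour at
    least 1, which suffices since [6 <= b2 m]. *)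
Lemma Staller_b2 m S v : 0 < m <= 2 -> fresh_le 3 S ->
    (forall x, x \notin S -> #|fresh S x| <= m.+1) -> legal S v ->
  pot b2 (S :|: N v) + (22 - b2 m) <= pot b2 S.
Proof.
move=> m12 S3 Sm; case/legalP=> u uv.
have b2m: 6 <= b2 m <= 7 by case: m m12 {Sm} => [|[|[|?]]].
have drop1 x w : w \in fresh S v -> w \in N x -> x \in S \/ x \in N v ->
    0 < drop b2 S v x.
  rewrite in_fresh => /andP[Sw vw] wx xP.
  have [Sx | Sx] := boolP (x \in S); first exact: (drop_b2_blue1 S v x w).
  case: xP => [|vx]; first by rewrite (negPf Sx).
  by have := drop_b2_white S v x m Sm Sx vx; nat_lia.
have [Sv | Sv] := boolP (v \in S); last first.
  have [x vx nxv] := Nneighbour v.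
  have us: uniq [:: v; x] by rewrite /= inE eq_sym nxv.
  apply: leq_trans (pot_gain b2 S v _ weights_b2 us); rewrite leq_add2l.
  rewrite !big_cons big_nil drop_self ?wt_white //; last exact: weights_b2.
  have: 0 < drop b2 S v x.
    by apply: (drop1 x v); rewrite ?in_fresh ?Sv ?Nrefl //; [apply: Nsym | right].
  by nat_lia.
have := uv; rewrite in_fresh => /andP[Su vu].
have nvu: v != u by apply: contraNneq Su => <-.
have [|t [ntv ntu vt ut]] := Ntriangle v u vu; first by rewrite eq_sym.
have us: uniq [:: v; u; t] by rewrite /= !inE negb_or nvu eq_sym ntv eq_sym ntu.
apply: leq_trans (pot_gain b2 S v _ weights_b2 us); rewrite leq_add2l.
rewrite !big_cons big_nil drop_self; last exact: weights_b2.
have := wt_blue b2 S v u weights_b2 Sv uv.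
have := drop_b2_white S v u m Sm Su vu.
have: 0 < drop b2 S v t by apply: (drop1 t u) => //; [apply: Nsym | right].
move: (wt b2 S v) (drop b2 S v u) (drop b2 S v t) (b2 m) b2m => x y z k.
by rewrite [b2 1]/=; nat_lia.
Qed.

(* Under this condition the undominated vertices split into cliques, and every
   vertex sees at most one of them, so each remaining move finishes a clique. *)
Definition settled S := forall v p, p \in fresh S v -> fresh S p = fresh S v.

Lemma settled_mono S A : settled S -> settled (S :|: A).
Proof.
have E v : fresh (S :|: A) v = fresh S v :\: A by rewrite /fresh setDDl.
by move=> Sq v p; rewrite !E inE => /andP[_ /Sq->].
Qed.

(** Every vertex seeing a newly dominated [u] has the same [fresh] set as [v], so its weight drops
    to 0. In a triangle at [u] this yields 15 from [u] and at least [b2 1 = 6] from each of the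
    other two. *)
Lemma settled_gain S v : settled S -> legal S v ->
  pot b2 (S :|: N v) + 27 <= pot b2 S.
Proof.
move=> Sq /legalP[u uv].
have := uv; rewrite in_fresh => /andP[Su vu].
have dropx x : u \in N x -> drop b2 S v x = wt b2 S x.
  move=> xu; have Ex: fresh S x = fresh S v.
    by rewrite -(Sq v u uv) (Sq x u) // in_fresh Su.
  have Sx': x \in S :|: N v.
    rewrite inE; case: (boolP (x \in S)) => //= Sx.
    have: x \in fresh S v by rewrite -(Sq v u uv) in_fresh Sx Nsym.
    by rewrite in_fresh => /andP[].
  rewrite /drop {2}/wt Sx'; suff ->: fresh (S :|: N v) x = set0.
    by rewrite cards0 subn0.
  by rewrite /fresh -setDDl -/(fresh S x) Ex /fresh setDDl setUC -setDDl setDv set0D.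
have wtx x : u \in N x -> 6 <= wt b2 S x.
  move=> xu; have [Sx|Sx] := boolP (x \in S); last by rewrite wt_white.
  by apply: (wt_blue b2 S x u weights_b2 Sx); rewrite in_fresh Su.
have [x ux nxu] := Nneighbour u.
have [z [nzu nzx uz _]] := Ntriangle u x ux nxu.
have us: uniq [:: u; x; z].
  by rewrite /= !inE negb_or (eq_sym u) nxu (eq_sym u) nzu eq_sym nzx.
apply: leq_trans (pot_gain b2 S v _ weights_b2 us); rewrite leq_add2l.
rewrite !big_cons big_nil dropx ?Nrefl // wt_white //.
have xu := Nsym _ _ ux; have zu := Nsym _ _ uz.
rewrite !dropx // addn0 -[27]/(15 + (6 + 6)) leq_add2l.
by apply: leq_add; apply: wtx.
Qed.

(** * Dominator's move while some vertex sees at least five undominated ones *)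

Lemma advance_pot b S v s d t : weights b -> legal S v -> uniq s ->
    d <= \sum_(x <- s) drop b S v x ->
    (forall w, legal (S :|: N v) w ->
      pot b (S :|: N v :|: N w) + t <= pot b (S :|: N v)) ->
    27 <= d -> 54 <= d + t ->
  advance (pot b) S.
Proof.
move=> wb lv us d_le tP d27 dt; exists v, d, t; split=> //.
by apply: leq_trans (pot_gain b S v s wb us); rewrite leq_add2l.
Qed.

Lemma sum_drop_fresh b S v c (A : {set V}) : {in A, forall x, c <= drop b S v x} ->
  #|A| * c <= \sum_(x <- enum A) drop b S v x.
Proof.
by move=> cP; rewrite big_enum /= -sum_nat_const; apply: leq_sum.
Qed.

Lemma legal_in S v x : x \notin S -> x \in N v -> legal S v.
Proof. by move=> Sx vx; apply/legalP; exists x; rewrite in_fresh Sx. Qed.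

(** Each newly dominated vertex other than [v] loses at least 6. An undominated [v] gives 15 + 4 * 6
    and a dominated one 9 + 5 * 6, in both cases 39 = 54 - 15. *)
Lemma advance_b0 S v : 5 <= #|fresh S v| -> advance (pot b0) S.
Proof.
move=> v5; have lv: legal S v by apply/legalP/card_gt0P; nat_lia.
have drop6 x : x \in fresh S v -> 6 <= drop b0 S v x.
  rewrite in_fresh => /andP[Sx vx].
  have := drop_white b0 S v x _ weights_b0 Sx vx (leqnn _).
  by case: #|_| => /= [|?]; nat_lia.
have us: uniq (v :: enum (fresh S v :\ v)).
  by rewrite /= enum_uniq mem_enum !inE eqxx.
apply: (@advance_pot b0 S v _ 39 15 weights_b0 lv us) => // [|w lw].
  rewrite big_cons drop_self; last exact: weights_b0.
  have: #|fresh S v :\ v| * 6 <= \sum_(x <- enum (fresh S v :\ v)) drop b0 S v x.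
    by apply: sum_drop_fresh => x /setD1P[_ /drop6].
  have := cardsD1 v (fresh S v); rewrite in_fresh Nrefl andbT.
  have [Sv | Sv] := boolP (v \in S); last by rewrite wt_white //=; nat_lia.
  have [u uv]: exists u, u \in fresh S v by apply/card_gt0P; nat_lia.
  by have := wt_blue b0 S v u weights_b0 Sv uv; rewrite /=; nat_lia.
exact: Staller_b0.
Qed.

(** * Dominator's move when the largest count is 4 *)

(** The four newly dominated vertices keep at most two undominated neighbours and lose 15 - 7 = 8
    each, so with the 9 from [v] the loss is 41 = 54 - 13. *)
Lemma advance_b1_blue S v : fresh_le 4 S ->
    (forall x, x \notin S -> #|fresh S x| <= 3) -> v \in S -> #|fresh S v| = 4 ->
  advance (pot b1) S.
Proof.
move=> S4 S3 Sv v4; have lv: legal S v by apply/legalP/card_gt0P; rewrite v4.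
have us: uniq (v :: enum (fresh S v)) by rewrite /= enum_uniq mem_enum !inE Sv.
apply: (@advance_pot b1 S v _ 41 13 weights_b1 lv us) => // [|w lw].
  rewrite big_cons drop_self /wt ?Sv ?v4; last exact: weights_b1.
  have: #|fresh S v| * 8 <= \sum_(x <- enum (fresh S v)) drop b1 S v x.
    apply: sum_drop_fresh => x; rewrite in_fresh => /andP[Sx vx].
    apply: (drop_white b1 S v x 2) => //; first exact: weights_b1.
    by have := fresh_after1 S v x x Sx vx (Nrefl x); have := S3 x Sx; nat_lia.
  by rewrite v4 /=; nat_lia.
by apply: Staller_b1 => //; apply: fresh_le_mono.
Qed.

(** Playing [v] yields 15 + 3 * 8 = 39, two short of the required 41. The vertex [y] supplies the
    rest, either as a further dominated vertex or as [q] losing 15 instead of 8. *)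
Lemma advance_b1_white_extra S v p q r y : fresh_le 4 S -> uniq [:: v; p; q; r] ->
    {subset [:: v; p; q; r] <= fresh S v} ->
    (y \in S /\ 2 <= drop b1 S v y) \/ (q = y /\ 15 <= drop b1 S v y) ->
  advance (pot b1) S.
Proof.
move=> S4 us sS yP.
have drop8 x : x \in [:: p; q; r] -> 8 <= drop b1 S v x.
  move=> sx; have: x \in fresh S v by apply: sS; rewrite inE sx orbT.
  rewrite in_fresh => /andP[Sx vx].
  have nvx: v != x by apply: contraTneq us => ->; rewrite /= sx.
  have Sv: v \notin S by have := sS v (mem_head _ _); rewrite in_fresh => /andP[].
  apply: (drop_white b1 S v x 2) => //; first exact: weights_b1.
  have := fresh_after2 S v x v x nvx Sv (Nrefl v) (Nsym _ _ vx) Sx vx (Nrefl x).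
  by have := S4 x; nat_lia.
have Sv: v \notin S by have := sS v (mem_head _ _); rewrite in_fresh => /andP[].
have lv := legal_in S v v Sv (Nrefl v).
have SP w : legal (S :|: N v) w ->
    pot b1 (S :|: N v :|: N w) + 13 <= pot b1 (S :|: N v).
  by apply: Staller_b1; apply: fresh_le_mono.
have dp := drop8 p (mem_head _ _).
have dq : 8 <= drop b1 S v q by apply: drop8; rewrite !inE eqxx orbT.
have dr : 8 <= drop b1 S v r by apply: drop8; rewrite !inE eqxx !orbT.
have dv : drop b1 S v v = 15.
  by rewrite drop_self ?wt_white //; apply: weights_b1.
case: yP => [[Sy dy] | [Eq dy]].
  have us': uniq [:: y, v, p, q & [:: r]].
    rewrite cons_uniq us andbT; apply/negP => /sS.
    by rewrite in_fresh Sy.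
  apply: (@advance_pot b1 S v _ 41 13 weights_b1 lv us') => //.
  by rewrite !big_cons big_nil; nat_lia.
apply: (@advance_pot b1 S v _ 41 13 weights_b1 lv us) => //.
by rewrite !big_cons big_nil; subst y; nat_lia.
Qed.

Lemma cards3 (A : {set V}) : #|A| = 3 ->
  exists p q r, [/\ p != q, p != r, q != r & A = [set p; q; r]].
Proof.
move=> A3; have [p Ap] : exists p, p \in A by apply/card_gt0P; rewrite A3.
have: #|A :\ p| == 2 by have := cardsD1 p A; rewrite Ap A3; nat_lia.
case/cards2P=> q [r [nqr Eqr]]; exists p, q, r.
have : q \in A :\ p by rewrite Eqr !inE eqxx.
have : r \in A :\ p by rewrite Eqr !inE eqxx orbT.
rewrite !inE => /andP[nrp _] /andP[nqp _]; split; rewrite // 1?eq_sym //.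
by rewrite -(setD1K Ap) Eqr setUA.
Qed.

(** Each of the three undominated neighbours of [v] lies in a triangle with [v]. If some third
    vertex is dominated, it sees two newly dominated vertices and loses at least 2. Otherwise one of
    the three is adjacent to both others and ends with weight 0. *)
Lemma advance_b1_white S v : fresh_le 4 S -> v \notin S -> #|fresh S v| = 4 ->
  advance (pot b1) S.
Proof.
move=> S4 Sv v4.
have: #|fresh S v :\ v| = 3.
  by have := cardsD1 v (fresh S v); rewrite in_fresh Sv Nrefl v4; nat_lia.
case/cards3=> p [q [r [npq npr nqr Epqr]]].
have vs x : (x \in fresh S v :\ v) = (x \in [:: p; q; r]).
  by rewrite Epqr !inE orbA.
have sS: {subset [:: v; p; q; r] <= fresh S v}.
  move=> x; rewrite inE => /orP[/eqP-> | ]; first by rewrite in_fresh Sv Nrefl.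
  by rewrite -vs => /setD1P[].
have us: uniq [:: v; p; q; r].
  by rewrite cons_uniq -vs !inE eqxx /= !inE negb_or npq npr nqr.
have third x : x \in [:: p; q; r] -> advance (pot b1) S \/
    exists z, [/\ z != x, z \in [:: p; q; r] & z \in N x].
  rewrite -vs => /setD1P[nxv]; rewrite in_fresh => /andP[Sx vx].
  have [z [nzv nzx vz xz]] := Ntriangle v x vx nxv.
  have [Sz | Sz] := boolP (z \in S); [left | right]; last first.
    by exists z; split; rewrite // -vs !inE nzv Sz.
  apply: (advance_b1_white_extra S v p q r z) => //; left; split=> //.
  rewrite drop_blue //.
  have := fresh_after2 S v z x v nxv Sx vx (Nsym _ _ xz) Sv (Nrefl v) (Nsym _ _ vz).
  have := S4 z.
  case: #|fresh S z| => [|[|[|[|[|?]]]]] //; case: #|_| => [|[|[|?]]] //; nat_lia.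
have centre x y z : perm_eq [:: v; x; y; z] [:: v; p; q; r] ->
    x \in N y -> z \in N y -> advance (pot b1) S.
  move=> xyz yx yz; have us': uniq [:: v; x; y; z] by rewrite (perm_uniq xyz).
  have sS' t : t \in [:: v; x; y; z] -> t \in fresh S v.
    by rewrite (perm_mem xyz); apply: sS.
  have vy: y \in fresh S v by apply: sS'; rewrite !inE eqxx !orbT.
  apply: (advance_b1_white_extra S v x y z y) => //; right; split=> //.
  move: (vy); rewrite in_fresh => /andP[Sy Nvy].
  apply: (drop_white b1 S v y 0) => //; first exact: weights_b1.
  rewrite -(leq_add2r 4) add0n; apply: leq_trans (S4 y).
  apply: (fresh_after S v y _ us') => t tP; have := sS' t tP; rewrite in_fresh => /andP[St vt]; split=> //.
  by move: tP; rewrite !inE => /or4P[] /eqP-> //; apply: Nsym.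
have [p_in [q_in r_in]]: p \in [:: p; q; r] /\ q \in [:: p; q; r] /\ r \in [:: p; q; r].
  by rewrite !inE !eqxx !orbT.
(* Each of [p], [q], [r] may now be assumed adjacent to another of them, so two of these adjacencies
   share an endpoint, which becomes the middle argument of [centre]. *)
have [//|[z [nzp]]] := third p p_in.
have perm_qpr : perm_eq [:: v; q; p; r] [:: v; p; q; r].
  by rewrite perm_cons (perm_catCA [:: q] [:: p] [:: r]).
have perm_prq : perm_eq [:: v; p; r; q] [:: v; p; q; r].
  by rewrite !perm_cons (perm_catC [:: r] [:: q]).
rewrite !inE (negPf nzp) /= => /orP[] /eqP-> pz.
  have [//|[y [nyr]]] := third r r_in.
  rewrite !inE (negPf nyr) orbF => /orP[] /eqP-> rz.
    by apply: (centre q p r) => //; apply: Nsym.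
  by apply: (centre p q r) => //; apply: Nsym.
have [//|[y [nyq]]] := third q q_in.
rewrite !inE (negPf nyq) /= => /orP[] /eqP-> qz.
  by apply: (centre q p r) => //; apply: Nsym.
by apply: (centre p r q) => //; apply: Nsym.
Qed.

(** * Dominator's move when the largest count is at most 3 *)

(** The reply costs at least [22 - b2 m], which leaves [32 + b2 m] for Dominator: 39 when [m] is 2
    and 38 when [m] is 1. *)
Lemma advance_b2 m S v s d : 0 < m <= 2 -> fresh_le 3 S ->
    (forall x, x \notin S -> #|fresh S x| <= m.+1) ->
    legal S v -> uniq s -> d <= \sum_(x <- s) drop b2 S v x ->
    32 + b2 m <= d -> advance (pot b2) S.
Proof.
move=> m12 S3 Sm lv us d_le le_d.
have b2m: b2 m <= 7 by case: m m12 {Sm le_d} => [|[|[|?]]].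
apply: (@advance_pot b2 S v s d (22 - b2 m) weights_b2 lv us d_le) => [w lw||]; try nat_lia.
apply: (Staller_b2 m) => // [|x]; first exact: fresh_le_mono.
rewrite inE negb_or => /andP[Sx _].
exact/(leq_trans _ (Sm x Sx))/subset_leq_card/fresh_sub.
Qed.

(** If the undominated neighbours [a] and [c] of [v] are adjacent, all three vertices drop to 0, a
    loss of 45. Otherwise they give 15 + 9 + 9 = 33, and the triangles on [v], [a] and on [v], [c]
    have dominated third vertices. These lose 3 each if distinct; if they coincide, that vertex
    loses 9. *)
Lemma advance_b2_white S v : fresh_le 3 S -> v \notin S -> #|fresh S v| = 3 ->
  advance (pot b2) S.
Proof.
move=> S3 Sv v3.
have: #|fresh S v :\ v| == 2.
  by have := cardsD1 v (fresh S v); rewrite in_fresh Sv Nrefl v3; nat_lia.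
case/cards2P=> a [c [nac Eac]].
have vs x : (x \in fresh S v :\ v) = (x == a) || (x == c) by rewrite Eac !inE.
have: a \in fresh S v :\ v by rewrite vs eqxx.
have: c \in fresh S v :\ v by rewrite vs eqxx orbT.
rewrite !in_setD1 !in_fresh => /and3P[ncv Sc vc] /and3P[nav Sa va].
have lv := legal_in S v v Sv (Nrefl v).
have us: uniq [:: v; a; c] by rewrite /= !inE negb_or (eq_sym v) nav eq_sym ncv nac.
have dv : drop b2 S v v = 15.
  by rewrite drop_self ?wt_white //; apply: weights_b2.
have S3' x : x \notin S -> #|fresh S x| <= 3 by move=> _; apply: S3.
have [ca | ca] := boolP (c \in N a).
  have drop15 x : x \in [:: v; a; c] -> 15 <= drop b2 S v x.
    move=> sx; have sP t : t \in [:: v; a; c] -> [/\ t \notin S, t \in N v & t \in N x].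
      have ac := Nsym _ _ ca; have av := Nsym _ _ va; have cv := Nsym _ _ vc.
      by move: sx; rewrite !inE => /or3P[] /eqP-> /or3P[] /eqP->; split.
    have := fresh_after S v x _ us sP; have := S3 x; rewrite /= => x3 x0.
    case: (sP x sx) => Sx vx _.
    apply: (drop_white b2 S v x 0) => //; first exact: weights_b2.
    by nat_lia.
  apply: (@advance_b2 2 S v _ 45 _ S3 S3' lv us) => //; rewrite !big_cons big_nil.
  have := drop15 v (mem_head _ _).
  have : 15 <= drop b2 S v a by apply: drop15; rewrite !inE eqxx orbT.
  have : 15 <= drop b2 S v c by apply: drop15; rewrite !inE eqxx !orbT.
  by nat_lia.
have drop9 x : x \notin S -> x \in N v -> x != v -> 9 <= drop b2 S v x.
  move=> Sx vx nxv; apply: (drop_white b2 S v x 1) => //; first exact: weights_b2.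
  have := fresh_after2 S v x x v nxv Sx vx (Nrefl x) Sv (Nrefl v) (Nsym _ _ vx).
  by have := S3 x; nat_lia.
have third x : (x == a) || (x == c) -> exists y, [/\ y \in S, y \in N v & y \in N x].
  rewrite -vs in_setD1 in_fresh => /and3P[nxv Sx vx].
  have [y [nyv nyx vy xy]] := Ntriangle v x vx nxv.
  exists y; split=> //; apply: contraR ca => Sy.
  have: y \in fresh S v :\ v by rewrite in_setD1 in_fresh nyv Sy.
  have: x \in fresh S v :\ v by rewrite in_setD1 in_fresh nxv Sx.
  rewrite !vs => /orP[] /eqP Ex /orP[] /eqP Ey; subst x y.
  - by rewrite eqxx in nyx.
  - by [].
  - exact: Nsym.
  - by rewrite eqxx in nyx.
have [|y [Sy vy ay]] := third a; first by rewrite eqxx.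
have [|z [Sz vz cz]] := third c; first by rewrite eqxx orbT.
have dy : 3 <= drop b2 S v y.
  by apply: (drop_b2_blue2 S v y a v) => //; apply: Nsym.
have dz : 3 <= drop b2 S v z.
  by apply: (drop_b2_blue2 S v z c v) => //; apply: Nsym.
have us' x : x \in S -> uniq [:: x; v; a; c].
  move=> Sx; rewrite cons_uniq us andbT; apply/negP.
  by rewrite !inE => /or3P[] /eqP Ex; move: Sx; rewrite Ex ?(negPf Sv) ?(negPf Sa) ?(negPf Sc).
have [Eyz | nyz] := eqVneq y z.
  subst z; apply: (@advance_b2 2 S v _ 39 _ S3 S3' lv (us' y Sy)) => //.
  have: 9 <= drop b2 S v y.
    rewrite drop_blue //; have := fresh_after S v y [:: v; a; c] us.
    have := S3 y; rewrite /= => y3 H.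
    have {}H : #|fresh (S :|: N v) y| + 3 <= #|fresh S y|.
      by apply: H => t; rewrite !inE => /or3P[] /eqP->; split=> //; apply: Nsym.
    have -> : #|fresh (S :|: N v) y| = 0 by nat_lia.
    by have -> : #|fresh S y| = 3 by nat_lia.
  by have := drop9 a Sa va nav; have := drop9 c Sc vc ncv; rewrite !big_cons big_nil; nat_lia.
have us2 : uniq [:: z; y; v; a; c].
  by rewrite cons_uniq us' // andbT inE negb_or eq_sym nyz; case/andP: (us' z Sz).
apply: (@advance_b2 2 S v _ 39 _ S3 S3' lv us2) => //.
by have := drop9 a Sa va nav; have := drop9 c Sc vc ncv; rewrite !big_cons big_nil; nat_lia.
Qed.

Lemma drop_b2_last S v x : x \notin S -> x \in N v -> #|fresh (S :|: N v) x| = 0 ->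
  drop b2 S v x = 15.
Proof.
by move=> Sx vx x0; rewrite /drop /wt inE (negPf Sx) vx x0.
Qed.

(** Playing [v] yields 9 + 3 * 9 = 36, two short of 38. If [p] or [q] keeps no undominated
    neighbour, it loses 15 instead of 9. Otherwise each has a dominated neighbour other than [v]:
    two distinct ones lose at least 1 each, a common one at least 3. *)
Lemma advance_b2_blue S v : fresh_le 3 S ->
    (forall x, x \notin S -> #|fresh S x| <= 2) -> v \in S -> #|fresh S v| = 3 ->
  advance (pot b2) S.
Proof.
move=> S3 S2 Sv v3; have lv: legal S v by apply/legalP/card_gt0P; rewrite v3.
case: (cards3 _ v3) => p [q [r [npq npr nqr Epqr]]].
have vs x : (x \in fresh S v) = (x \in [:: p; q; r]) by rewrite Epqr !inE orbA.
have us: uniq [:: v; p; q; r].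
  by rewrite cons_uniq -vs in_fresh Sv /= !inE negb_or npq npr nqr.
have drop9 x : x \in [:: p; q; r] -> 9 <= drop b2 S v x.
  rewrite -vs in_fresh => /andP[Sx vx].
  exact: (drop_b2_white S v x 1).
have [p_in [q_in r_in]]: p \in [:: p; q; r] /\ q \in [:: p; q; r] /\ r \in [:: p; q; r].
  by rewrite !inE !eqxx !orbT.
have dv : drop b2 S v v = 9.
  by rewrite drop_self /wt ?Sv ?v3 //; apply: weights_b2.
have dp := drop9 p p_in; have dq := drop9 q q_in; have dr := drop9 r r_in.
(* A neighbour [x] of [v] which is still adjacent to an undominated vertex [z]
   lies with [z] in a triangle whose third vertex is dominated and sees [z], so
   it is not [v]. *)
have third x : x \in [:: p; q; r] -> drop b2 S v x = 15 \/
    exists t, [/\ t \in S, t != v & t \in N x].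
  rewrite -vs in_fresh => /andP[Sx vx].
  have [x0 | /card_gt0P[z]] := posnP #|fresh (S :|: N v) x|.
    by left; apply: drop_b2_last.
  rewrite in_fresh inE negb_or => /andP[/andP[Sz vz] xz].
  have nzx: z != x by apply: contraNneq vz => ->.
  have [t [ntx ntz xt zt]] := Ntriangle x z xz nzx.
  right; exists t; split=> //; last by apply: contraNneq vz => <-; apply: Nsym.
  apply: contraLR (S2 x Sx) => St; rewrite -ltnNge.
  have ut: uniq [:: x; z; t] by rewrite /= !inE negb_or (eq_sym x) nzx (eq_sym x) ntx eq_sym ntz.
  rewrite -[3]/(size [:: x; z; t]) -(card_uniqP ut); apply/subset_leq_card/subsetP => w.
  by rewrite !inE => /or3P[] /eqP->; rewrite ?Sx ?Sz ?St ?Nrefl.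
have S2' x : x \notin S -> #|fresh S x| <= 1.+1 by apply: S2.
have us' t : t \in S -> t != v -> uniq [:: t; v; p; q; r].
  by move=> St ntv; rewrite cons_uniq us andbT inE negb_or ntv -vs in_fresh St.
have [dp' | [t [St ntv pt]]] := third p p_in.
  apply: (@advance_b2 1 S v _ 38 _ S3 S2' lv us) => //.
  by rewrite !big_cons big_nil; nat_lia.
have [dq' | [z [Sz nzv qz]]] := third q q_in.
  apply: (@advance_b2 1 S v _ 38 _ S3 S2' lv us) => //.
  by rewrite !big_cons big_nil; nat_lia.
move: p_in q_in; rewrite -!vs !in_fresh => /andP[Sp vp] /andP[Sq vq].
have [Etz | ntz] := eqVneq t z.
  subst z; apply: (@advance_b2 1 S v _ 38 _ S3 S2' lv (us' t St ntv)) => //.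
  have: 3 <= drop b2 S v t by apply: (drop_b2_blue2 S v t p q) => //; apply: Nsym.
  by rewrite !big_cons big_nil; nat_lia.
have us2 : uniq [:: z; t; v; p; q; r].
  by rewrite cons_uniq us' // andbT inE negb_or eq_sym ntz; case/andP: (us' z Sz nzv).
apply: (@advance_b2 1 S v _ 38 _ S3 S2' lv us2) => //.
have: 0 < drop b2 S v t by apply: (drop_b2_blue1 S v t p) => //; apply: Nsym.
have: 0 < drop b2 S v z by apply: (drop_b2_blue1 S v z q) => //; apply: Nsym.
by rewrite !big_cons big_nil; nat_lia.
Qed.

Lemma fresh_le2P S x y z : fresh_le 2 S -> x != y -> x \in fresh S z ->
  y \in fresh S z -> fresh S z = [set x; y].
Proof.
move=> S2 nxy xz yz; apply/eqP; rewrite eq_sym eqEcard cards2 nxy S2 andbT.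
by apply/subsetP => w; rewrite !inE => /orP[] /eqP->; rewrite -in_fresh.
Qed.

(** Dominator plays [p]. A vertex seeing both [p] and [q] has no other undominated neighbour, so [p]
    and [q] lose 15 each and the third vertex of their triangle loses [b2 2 = 7]. Since [v] sees [p]
    but not [q], it is a further vertex and loses at least 1, for a total of 38. *)
Lemma advance_b2_pair S v p q : fresh_le 2 S -> p \notin S -> q \notin S -> p != q ->
  q \in N p -> p \in N v -> q \notin N v -> advance (pot b2) S.
Proof.
move=> S2 Sp Sq npq pq vp vq.
have S3 : fresh_le 3 S by move=> x; apply: leq_trans (S2 x) _.
have [|t [ntp ntq pt qt]] := Ntriangle p q pq; first by rewrite eq_sym.
have fp: p \in fresh S p by rewrite in_fresh Sp Nrefl.
have fq: q \in fresh S p by rewrite in_fresh Sq.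
have pS x : x \in N p -> x != p -> x != q -> x \in S.
  move=> px nxp nxq; apply: contraT => Sx.
  have: x \in fresh S p by rewrite in_fresh Sx.
  by rewrite (fresh_le2P S p q p) // !inE (negPf nxp) (negPf nxq).
have St : t \in S by apply: pS.
have nvp : v != p by apply: contraNneq vq => ->.
have nvq : v != q by apply: contraNneq vq => ->; apply: Nrefl.
have Sv : v \in S by apply: pS => //; apply: Nsym.
have nvt : v != t by apply: contraNneq vq => ->; apply: Nsym.
have us : uniq [:: p; q; t; v].
  by rewrite /= !inE !negb_or npq (eq_sym p) ntp (eq_sym p) nvp (eq_sym q) ntq (eq_sym q) nvq eq_sym nvt.
have ep x : p \in N x -> q \in N x -> #|fresh S x| = 2 /\ #|fresh (S :|: N p) x| = 0.
  move=> xp xq; have := S2 x.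
  by have := fresh_after2 S p x p q npq Sp (Nrefl p) xp Sq pq xq; nat_lia.
apply: (@advance_b2 1 S p _ 38 _ S3 (fun x _ => S2 x) _ us) => //.
  exact: (legal_in S p p).
have dv: 0 < drop b2 S p v by apply: (drop_b2_blue1 S p v p) => //; apply: Nrefl.
have dt: drop b2 S p t = 7.
  by rewrite drop_blue //; have [-> ->] := ep t (Nsym _ _ pt) (Nsym _ _ qt).
have dp: drop b2 S p p = 15.
  by apply: drop_b2_last => //; have [] := ep p (Nrefl p) pq.
have dq: drop b2 S p q = 15.
  by apply: drop_b2_last => //; have [] := ep q (Nsym _ _ pq) (Nrefl q).
by rewrite !big_cons big_nil; nat_lia.
Qed.

Lemma advance_b2_unsettled S v p : fresh_le 2 S -> p \in fresh S v ->
  fresh S p != fresh S v -> advance (pot b2) S.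
Proof.
move=> S2 pv; have S3 : fresh_le 3 S by move=> x; apply: leq_trans (S2 x) _.
rewrite eqEsubset negb_and => /orP[] /subsetPn[q].
  rewrite !in_fresh => /andP[Sq pq]; rewrite Sq /= => vq.
  move: pv; rewrite in_fresh => /andP[Sp vp].
  by apply: (advance_b2_pair S v p q) => //; apply: contraNneq vq => <-.
(* The remaining case: [v] sees two non-adjacent undominated vertices [p] and [q], and no others. *)
move=> qv pq; have npq: p != q.
  by apply: contraNneq pq => <-; move: pv; rewrite !in_fresh Nrefl => /andP[->].
have Ev := fresh_le2P S p q v S2 npq pv qv.
have [Sp vp] : p \notin S /\ p \in N v by apply/andP; rewrite -in_fresh.
have [Sq vq] : q \notin S /\ q \in N v by apply/andP; rewrite -in_fresh.
rewrite in_fresh Sq /= in pq.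
have Sv : v \in S.
  apply: contraT => Sv; have: v \in fresh S v by rewrite in_fresh Sv Nrefl.
  by rewrite Ev !inE => /orP[] /eqP E; move: pq; rewrite -E ?vq ?(Nsym _ _ vp).
have nvp: v != p by apply: contraNneq Sp => <-.
have nvq: v != q by apply: contraNneq Sq => <-.
(* An undominated neighbour [y] of [p] or [q] is not seen by [v], so [advance_b2_pair] applies.
   Without such [y], playing [v] gives 15 + 15 + 7, and the third vertex [t] of a triangle on [v]
   and [p] adds the missing 1. *)
have isolated x y : x \in [:: p; q] -> y \notin S -> y \in N x -> y != x -> advance (pot b2) S.
  move=> xpq Sy xy nyx; have xv: x \in fresh S v.
    by rewrite Ev; move: xpq; rewrite !inE.
  move: (xv); rewrite in_fresh => /andP[Sx vx].
  apply: (advance_b2_pair S v x y) => //; first by rewrite eq_sym.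
  apply/negP => vy; have: y \in fresh S v by rewrite in_fresh Sy.
  rewrite Ev; move: xpq nyx xy; rewrite !inE => /orP[] /eqP -> nyx xy /orP[] /eqP Ey; subst y.
  - by rewrite eqxx in nyx.
  - by rewrite xy in pq.
  - by rewrite (Nsym _ _ xy) in pq.
  - by rewrite eqxx in nyx.
have [|t [ntv ntp vt pt]] := Ntriangle v p vp; first by rewrite eq_sym.
have [St | St] := boolP (t \in S); last first.
  by apply: (isolated p t); rewrite ?inE ?eqxx.
have nt x : x \notin S -> t != x by apply: contraNneq => <-.
have us : uniq [:: v; p; q; t].
  by rewrite /= !inE !negb_or nvp nvq npq (eq_sym v) ntv (eq_sym p) ntp eq_sym nt.
have last x : x \in [:: p; q] -> drop b2 S v x = 15 \/ advance (pot b2) S.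
  move=> xpq; have xv: x \in fresh S v by rewrite Ev; move: xpq; rewrite !inE.
  move: (xv); rewrite in_fresh => /andP[Sx vx].
  have [x0 | /card_gt0P[y]] := posnP #|fresh (S :|: N v) x|.
    by left; apply: drop_b2_last.
  rewrite in_fresh inE negb_or => /andP[/andP[Sy vy] xy].
  by right; apply: (isolated x y) => //; apply: contraNneq vy => ->.
have [dp | //] := last p (mem_head _ _).
have [|dq | //] := last q; first by rewrite !inE eqxx orbT.
apply: (@advance_b2 1 S v _ 38 _ S3 (fun x _ => S2 x) _ us) => //.
  exact: (legal_in S v p).
have dt: 0 < drop b2 S v t by apply: (drop_b2_blue1 S v t p) => //; apply: Nsym.
have dv: drop b2 S v v = 7.
  by rewrite drop_self /wt ?Sv ?Ev ?cards2 ?npq //; apply: weights_b2.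
by rewrite !big_cons big_nil; nat_lia.
Qed.

(** * Chaining the phases *)

(** Every single move, by either player, costs 27, so no pairing of moves is required. *)
Lemma bound_settled k dom S : settled S -> 27 * gval N k dom S <= pot b2 S.
Proof.
elim: k dom S => [|k IH] dom S Sq; first by rewrite muln0.
have [/existsP[w lw] | /existsPn fin] := boolP [exists w, legal S w]; last first.
  by rewrite (gval_final k.+1) // muln0.
have gain v : legal S v -> 27 * gval N k (~~ dom) (S :|: N v) + 27 <= pot b2 S.
  move=> lv; apply: leq_trans (settled_gain S v Sq lv); rewrite leq_add2r.
  exact/IH/settled_mono.
case: dom gain => gain.
  by have := gain w lw; have := gval_Dominator k S w lw; rewrite [~~ _]/=; nat_lia.
have := gval_Staller k S ((pot b2 S - 27) %/ 27).
have le_w v : legal S v -> gval N k true (S :|: N v) <= (pot b2 S - 27) %/ 27.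
  by move=> /gain /=; rewrite leq_divRL // mulnC; nat_lia.
by move=> /(_ le_w); have := gain w lw; have := leq_trunc_div (pot b2 S - 27) 27; nat_lia.
Qed.

(** Undominated vertices of count 3 are treated first, so that the dominated case may assume count
    at most 2 at undominated vertices. *)
Lemma bound_b2 k S : fresh_le 3 S -> 27 * gval N k true S <= pot b2 S.
Proof.
apply: (potential_bound (fresh_le 3)) => [|{k}S S3]; first exact: fresh_le_mono.
have [/existsP[v /andP[Sv /eqP v3]] | /existsPn white2] :=
  boolP [exists v, (v \notin S) && (#|fresh S v| == 3)].
  by left; apply: (advance_b2_white S v).
have [/existsP[v /andP[Sv /eqP v3]] | /existsPn blue2] :=
  boolP [exists v, (v \in S) && (#|fresh S v| == 3)].
  left; apply: (advance_b2_blue S v) => // x Sx.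
  by have := white2 x; have := S3 x; rewrite Sx /=; nat_lia.
have S2 : fresh_le 2 S.
  move=> x; have := white2 x; have := blue2 x; have := S3 x.
  by case: (x \in S) => /=; nat_lia.
have [/existsP[v /existsP[p /andP[pv np]]] | st] :=
  boolP [exists v, exists p, (p \in fresh S v) && (fresh S p != fresh S v)].
  by left; apply: (advance_b2_unsettled S v p).
right=> k; apply: bound_settled => v p pv; apply/eqP; apply: contraR st => np.
by apply/existsP; exists v; apply/existsP; exists p; rewrite pv.
Qed.

Lemma bound_b1 k S : fresh_le 4 S -> 27 * gval N k true S <= pot b1 S.
Proof.
apply: (potential_bound (fresh_le 4)) => [|{k}S S4]; first exact: fresh_le_mono.
have [/existsP[v /andP[Sv /eqP v4]] | /existsPn white3] :=
  boolP [exists v, (v \notin S) && (#|fresh S v| == 4)].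
  by left; apply: (advance_b1_white S v).
have [/existsP[v /andP[Sv /eqP v4]] | /existsPn blue3] :=
  boolP [exists v, (v \in S) && (#|fresh S v| == 4)].
  left; apply: (advance_b1_blue S v) => // x Sx.
  by have := white3 x; have := S4 x; rewrite Sx /=; nat_lia.
right=> k; apply: leq_trans (bound_b2 k S _) _ => [x|].
  have := white3 x; have := blue3 x; have := S4 x.
  by case: (x \in S) => /=; nat_lia.
by apply: pot_le => x _; case: #|_| => [|[|[|?]]].
Qed.

Lemma bound_b0 k S : 27 * gval N k true S <= pot b0 S.
Proof.
apply: (potential_bound (fun=> True)) => {k S}// S _.
have [/existsP[v v5] | /existsPn S4] := boolP [exists v, 5 <= #|fresh S v|].
  by left; apply: (advance_b0 S v).
right=> k; apply: leq_trans (bound_b1 k S _) _ => [x|].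
  by have := S4 x; rewrite -leqNgt.
by apply: pot_le => x _; case: #|_| => [|[|[|?]]].
Qed.

Lemma gamma_g_triangle : 9 * gamma_g N <= 5 * #|V|.
Proof.
have := bound_b0 #|V| set0; rewrite -/(gamma_g N) /pot.
rewrite (eq_bigr (fun=> 15)) => [|x _]; last by rewrite wt_white ?inE.
by rewrite sum_nat_const -[#|xpredT|]/#|V|; nat_lia.
Qed.

End DominationGame.

(** * Hypergraphs and graphs as instances *)

Theorem theorem3 :
  (forall (V : finType) (E : {set {set V}}),
     (forall e, e \in E -> #|e| = 3) ->
     (forall v : V, exists2 e, e \in E & v \in e) ->
     9 * gamma_g (hnbhd E) <= 5 * #|V|)
  /\
  (forall (V : finType) (r : rel V),
     symmetric r -> irreflexive r ->
     (forall v : V, exists u, r v u) ->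
     (forall u v : V, r u v -> exists w, r u w && r v w) ->
     9 * gamma_g (gnbhd r) <= 5 * #|V|).
Proof.
split=> [V E E3 Ecover | V r rsym rirr rdeg rtri].
  have inN e x y : e \in E -> x \in e -> y \in e -> y \in hnbhd E x.
    move=> Ee ex ey; rewrite !inE; apply/orP; right.
    by apply/existsP; exists e; rewrite Ee ex ey.
  (* Since [x] and [y] may coincide, this provides both a neighbour of [x] and the third vertex of a
     triangle. *)
  have thirdE e x y : e \in E -> exists z, [/\ z != x, z != y & z \in e].
    move=> /E3 e3; have: 0 < #|e :\ x :\ y|.
      have := cardsD1 x e; have := cardsD1 y (e :\ x).
      by case: (x \in e) (y \in _) => -[]; nat_lia.
    by case/card_gt0P=> z; rewrite !inE => /and3P[zy zx ez]; exists z.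
  apply: gamma_g_triangle => [x | x y | x | x y].
  - by rewrite !inE eqxx.
  - rewrite !inE => /predU1P[-> | /existsP[e /and3P[Ee ey ex]]].
      by rewrite eqxx.
    by apply/orP; right; apply/existsP; exists e; rewrite Ee ex ey.
  - have [e Ee ex] := Ecover x; have [z [zx _ ez]] := thirdE e x x Ee.
    by exists z => //; apply: (inN e).
  rewrite !inE => /orP[-> // | /existsP[e /and3P[Ee ex ey]]] _.
  have [z [zx zy ez]] := thirdE e x y Ee.
  by exists z; split; rewrite // (inN e).
apply: gamma_g_triangle => [x | x y | x | x y].
- by rewrite !inE eqxx.
- by rewrite !inE rsym eq_sym.
- have [y xy] := rdeg x; exists y; first by rewrite !inE xy orbT.
  by apply: contraTneq xy => ->; rewrite rirr.
rewrite !inE => /orP[-> // | xy] _.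
have [z /andP[xz yz]] := rtri x y xy.
exists z; rewrite !inE xz yz !orbT; split=> //.
  by apply: contraTneq xz => ->; rewrite rirr.
by apply: contraTneq yz => ->; rewrite rirr.
Qed.
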